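(* Let $X_1,X_2,\ldots,X_n$, $n\ge2$, be independent integer valued random variables and $W=\sum_{j=1}^nX_j$. Then $$d_{\mathrm{TV}}(\mathcal D(W),\mathcal D(W+1))\le\frac4{l\sqrt{nlp}}+\frac{8d_n}{nlp},$$ where $l\in\{2,4,6,\ldots\}$ and $0<p\le\min\{\mathbf P(X_j=k):k=1,\ldots,l,\ j=1,\ldots,n\}$ are arbitrary and $d_n=d_{\mathrm{TV}}(\mathcal D(X_n),\mathcal D(X_n+1))$.
   Context: $\mathcal D(X)$ is the distribution of $X$, and $d_{\mathrm{TV}}(\mu,\nu)=\sup_{A\subset\mathbb{Z}}|\mu(A)-\nu(A)|$ for probability measures $\mu,\nu$ on $\mathbb{Z}$. *)

(* Defs.v *)
From HB Require Import structures.
From mathcomp Require Import all_boot all_order all_algebra.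
From mathcomp Require Import all_classical all_reals all_analysis.

Set Implicit Arguments.
Unset Strict Implicit.
Unset Printing Implicit Defensive.

Import Order.TTheory GRing.Theory Num.Theory.

Local Open Scope classical_set_scope.
Local Open Scope ring_scope.

HB.instance Definition _ := isPointed.Build int 0.

(* The integers carry the discrete sigma-algebra, so that every A : set int is
   measurable. *)
HB.instance Definition _ := @isMeasurable.Build default_measure_display
  int discrete_measurable discrete_measurable0
  discrete_measurableC discrete_measurableU.

Definition independent_RVs d d' (T : measurableType d) (T' : measurableType d')
    (R : realType) (P : probability T R) (I : finType)
    (X : I -> {RV P >-> T'}) : Prop :=
  forall (J : {set I}) (B : I -> set T'), (forall j, measurable (B j)) ->
    (P (\bigcap_(j in [set` J]) (X j @^-1` B j)) =
     \prod_(j in J) P (X j @^-1` B j))%E.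

(* The set is nonempty and bounded by 1, so sup is its true supremum. *)
Definition dTV (R : realType) (mu nu : probability int R) : R :=
  sup [set `|fine (mu A) - fine (nu A)| | A in [set: set int]].

Section integer_valued_RVs.
Context d (T : measurableType d) (R : realType) (P : probability T R).

Lemma measurable_fun_int (f : T -> int) :
  (forall k, measurable (f @^-1` [set k])) -> measurable_fun setT f.
Proof.
move=> mf _ A _; rewrite setTI.
have -> : f @^-1` A = \bigcup_(k in A) (f @^-1` [set k]).
  by apply/seteqP; split=> [t Aft|t [k Ak /= ->]]; [exists (f t)|].
rewrite bigcup_mkcond.
by apply: countable_bigcupT_measurable => [|k]; first exact: countableP; case: ifPn.
Qed.

Lemma measurable_fun_int_add (f g : T -> int) :
  measurable_fun setT f -> measurable_fun setT g ->
  measurable_fun setT (fun t => f t + g t).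
Proof.
move=> mf mg; apply: measurable_fun_int => k.
have -> : (fun t => f t + g t) @^-1` [set k] =
    \bigcup_i ((f @^-1` [set i]) `&` (g @^-1` [set k - i])).
  apply/seteqP; split=> [t /= <-|t [i _ [/= -> ->]]]; last by rewrite addrC subrK.
  by exists (f t) => //=; rewrite addrC addKr.
apply: countable_bigcupT_measurable => [|i]; first exact: countableP.
by apply: measurableI; rewrite -[X in measurable X]setTI; [exact: mf|exact: mg].
Qed.

Definition RV_sum (n : nat) (X : 'I_n -> {RV P >-> int}) : T -> int :=
  fun t => \sum_(j < n) X j t.

Lemma measurable_RV_sum n (X : 'I_n -> {RV P >-> int}) :
  measurable_fun setT (RV_sum X).
Proof.
rewrite /RV_sum; elim: n X => [|n IHn] X.
  by under eq_fun do rewrite big_ord0; exact: measurable_cst.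
under eq_fun do rewrite big_ord_recl.
by apply: measurable_fun_int_add; [exact: measurable_funPT|exact: IHn].
Qed.

HB.instance Definition _ n (X : 'I_n -> {RV P >-> int}) :=
  isMeasurableFun.Build _ _ _ _ (RV_sum X) (measurable_RV_sum X).

Definition RV_succ (X : {RV P >-> int}) : T -> int := fun t => X t + 1.

Lemma measurable_RV_succ (X : {RV P >-> int}) :
  measurable_fun setT (RV_succ X).
Proof.
by apply: measurable_fun_int_add; [exact: measurable_funPT|exact: measurable_cst].
Qed.

HB.instance Definition _ (X : {RV P >-> int}) :=
  isMeasurableFun.Build _ _ _ _ (RV_succ X) (measurable_RV_succ X).

End integer_valued_RVs.

(* Main.v *)
Require Import Defs.
From mathcomp Require Import all_boot all_order all_algebra.
From mathcomp Require Import all_classical all_reals all_analysis.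
From mathcomp Require Import ring lra zify.

(* Write U for the operator averaging a function over its translates by
   1, ..., l, put q = l p, and let D h (k) = h k - h (k + 1). Translation by X_j,
   h |-> E h(. + X_j), equals q U plus a positive operator of mass 1 - q. Starting
   from h k = P(X_n + k \in A) and applying these operators one at a time, every
   bound |D U^N h| <= beta N becomes a bound q beta (N + 1) + (1 - q) beta N, so that
   in the end D is applied after a binomial number of factors U. Without any
   factor U, D costs d_n; with N >= 1 of them it costs at most 2 / (l sqrt (N + 1)),
   because the central binomial coefficient is at most 2^N / sqrt (N + 1). *)

Set Implicit Arguments.
Unset Strict Implicit.
Unset Printing Implicit Defensive.

Import Order.TTheory GRing.Theory Num.Theory.

Local Open Scope classical_set_scope.
Local Open Scope ring_scope.

(** * Binomial coefficients: unimodality and the size of the central one *)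

Lemma leq_binS n i : (i.*2 < n)%N -> ('C(n, i) <= 'C(n, i.+1))%N.
Proof.
move=> lt_in; rewrite -(leq_pmul2l (ltn0Sn i)) mul_bin_left leq_mul2r.
by apply/orP; right; lia.
Qed.

Lemma geq_binS n i : (n <= i.*2.+1)%N -> ('C(n, i.+1) <= 'C(n, i))%N.
Proof.
move=> le_ni; rewrite -(leq_pmul2l (ltn0Sn i)) mul_bin_left leq_mul2r.
by apply/orP; right; lia.
Qed.

Lemma central_binS n : (n.+1 * 'C(n.+1.*2, n.+1) = (n.*2.+1).*2 * 'C(n.*2, n))%N.
Proof.
have e1 := mul_bin_diag n.+1.*2 n; rewrite /= in e1.
have e2 := mul_bin_diag n.*2.+1 n.
have e3 := mul_bin_down n.*2.+1 n; rewrite /= in e3.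
have -> : (n.+1 * 'C(n.+1.*2, n.+1) = n.+1.*2 * 'C(n.*2.+1, n))%N by rewrite e1.
have e4 : (n.*2.+1 - n = n.+1)%N by lia.
rewrite e4 in e3; nia.
Qed.

(** By [central_binS] the left side is multiplied by 4 (2n + 1) (2n + 3) / (n + 1)^2 from n to n +
    1, which is at most 16 because (2n + 1) (2n + 3) <= (2n + 2)^2. *)
Lemma sqr_central_bin_le n : ('C(n.*2, n) ^ 2 * n.*2.+1 <= 16 ^ n)%N.
Proof.
elim: n => // n IHn.
rewrite -(leq_pmul2l (_ : 0 < n.+1 ^ 2)%N) // mulnA -expnMn central_binS.
have -> : (((n.*2.+1).*2 * 'C(n.*2, n)) ^ 2 * (n.+1.*2).+1 =
  ('C(n.*2, n) ^ 2 * n.*2.+1) * (4 * (n.*2.+1 * n.+1.*2.+1)))%N.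
  by rewrite -[(n.*2.+1).*2]muln2; move: n.*2.+1 n.+1.*2.+1 'C(_, _) => x y z; ring.
rewrite [(16 ^ _)%N]expnS [leqRHS]mulnA [leqRHS]mulnC; apply: leq_mul => //.
by rewrite -mulnn; nia.
Qed.

(** Write n = b + 2a with b the parity. The even case is the previous lemma; the odd one reduces to
    it through C(2a + 1, a) = (2a + 1) / (a + 1) C(2a, a). Squaring keeps the estimate inside the
    natural numbers. *)
Lemma sqr_bin_half_le n : ('C(n, n./2) ^ 2 * n.+1 <= 4 ^ n)%N.
Proof.
suff key (b : bool) a :
    ('C(b + a.*2, a) ^ 2 * (b + a.*2).+1 <= 4 ^ (b + a.*2))%N.
  by have := key (odd n) n./2; rewrite odd_double_half.
have e4 : (4 ^ a.*2 = 16 ^ a)%N by rewrite -muln2 mulnC expnM.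
case: b; rewrite ?add0n ?e4 ?sqr_central_bin_le// add1n [(4 ^ _)%N]expnS e4.
have e : (a.+1 * 'C(a.*2.+1, a) = a.*2.+1 * 'C(a.*2, a))%N.
  by have := mul_bin_down a.*2.+1 a; rewrite /= => ->; congr muln; lia.
rewrite -(leq_pmul2l (_ : 0 < a.+1 ^ 2)%N) // mulnA -expnMn e.
have -> : ((a.*2.+1 * 'C(a.*2, a)) ^ 2 * a.*2.+2 =
  ('C(a.*2, a) ^ 2 * a.*2.+1) * (a.*2.+1 * a.*2.+2))%N.
  by move: a.*2.+1 a.*2.+2 'C(_, _) => x y z; ring.
rewrite [leqRHS]mulnA [leqRHS]mulnC.
apply: leq_mul; first exact: sqr_central_bin_le.
by rewrite -mulnn; nia.
Qed.

(** Summation by parts: up to the mode t the increments of c are nonnegative and g <= 1 lets them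
    add up to c t; beyond t they are nonpositive and g >= 0 discards them. The two inductions carry
    the boundary term in g along. *)
Lemma sum_unimodal_le (R : realDomainType) (c g : nat -> R) t n :
  (forall i, 0 <= c i) ->
  (forall i, (i < t)%N -> c i <= c i.+1) ->
  (forall i, (t <= i)%N -> c i.+1 <= c i) ->
  (forall i, 0 <= g i <= 1) -> (t <= n)%N ->
  \sum_(i < n.+1) c i * (g i - g i.+1) <= c t.
Proof.
move=> c0 cup cdown g01 tn.
have up s : (s <= t)%N ->
    \sum_(i < s.+1) c i * (g i - g i.+1) <= c s * (1 - g s.+1).
  elim: s => [|s IHs] st.
    by rewrite big_ord1 ler_wpM2l// lerD2r; case/andP: (g01 0).
  rewrite big_ord_recr /=; have := IHs (ltnW st); have := cup _ st.
  have := g01 s.+1; nra.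
suff down u : \sum_(i < (t + u).+1) c i * (g i - g i.+1) <=
    c t - c (t + u)%N * g (t + u).+1.
  rewrite -(subnKC tn) (le_trans (down _))// lerBlDr lerDl mulr_ge0//.
  by case/andP: (g01 (t + (n - t)).+1).
elim: u => [|u IHu].
  by rewrite addn0 (le_trans (up _ _))//; lra.
rewrite addnS big_ord_recr /=; have := IHu.
have := cdown (t + u)%N (leq_addr _ _); have := g01 (t + u).+1; nra.
Qed.

Lemma sum_bin_sub_le (R : realDomainType) (g : nat -> R) n :
  (forall i, 0 <= g i <= 1) ->
  `|\sum_(i < n.+1) 'C(n, i)%:R * (g i - g i.+1)| <= 'C(n, n./2)%:R.
Proof.
move=> g01; have le_half : (n./2 <= n)%N by lia.
have key (h : nat -> R) : (forall i, 0 <= h i <= 1) ->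
    \sum_(i < n.+1) 'C(n, i)%:R * (h i - h i.+1) <= 'C(n, n./2)%:R :> R.
  move=> h01; apply: (@sum_unimodal_le _ (fun i => 'C(n, i)%:R)) => // i le_i.
    by rewrite ler_nat leq_binS //; lia.
  by rewrite ler_nat geq_binS //; lia.
rewrite ler_norml key// andbT lerNl -sumrN.
(* Replacing g by 1 - g reverses the sign of the sum, so the upper bound also yields the lower
   one. *)
rewrite (le_trans _ (key (fun i => 1 - g i) _))//; last first.
  by move=> i; have := g01 i; lra.
by rewrite le_eqVlt; apply/orP; left; apply/eqP/eq_bigr => i _; ring.
Qed.

Lemma bin_half_le (R : rcfType) n :
  'C(n, n./2)%:R / 2 ^+ n <= (Num.sqrt n.+1%:R)^-1 :> R.
Proof.
rewrite ler_pdivrMr ?exprn_gt0// mulrC ler_pdivlMr ?sqrtr_gt0//.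
rewrite -(ler_pXn2r (ltn0Sn 1)) ?nnegrE ?mulr_ge0 ?exprn_ge0 ?sqrtr_ge0//.
rewrite exprMn sqr_sqrtr// -exprM mulnC exprM -!natrX -natrM ler_nat.
exact: sqr_bin_half_le.
Qed.

(** * Polynomials in the shift operator *)

Section PolynomialAction.
Variable R : comNzRingType.
Implicit Types (P Q : {poly R}) (h : int -> R) (k : int).

(** ['X] acts as translation by 1, so products of polynomials become compositions of operators, and
    operator identities reduce to identities in the commutative ring [{poly R}]. The difference
    operator D is [1 - 'X]. *)
Definition poly_act P h k : R := \sum_(i < size P) P`_i * h (k + i%:Z).

Lemma poly_act_widen n P h k : (size P <= n)%N ->
  poly_act P h k = \sum_(i < n) P`_i * h (k + i%:Z).
Proof.
move=> sPn.
rewrite /poly_act (big_ord_widen _ (fun i => P`_i * h (k + i%:Z)) sPn).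
rewrite big_mkcond; apply: eq_bigr => i _; case: ltnP => // si.
by rewrite nth_default// mul0r.
Qed.

Lemma eq_poly_act P h1 h2 : h1 =1 h2 -> poly_act P h1 =1 poly_act P h2.
Proof. by move=> eh k; apply: eq_bigr => i _; rewrite eh. Qed.

Lemma poly_act0 h k : poly_act 0 h k = 0.
Proof. by rewrite /poly_act size_poly0 big_ord0. Qed.

Lemma poly_actD P Q h k : poly_act (P + Q) h k = poly_act P h k + poly_act Q h k.
Proof.
rewrite (@poly_act_widen (maxn (size P) (size Q)) P) ?leq_maxl//.
rewrite (@poly_act_widen (maxn (size P) (size Q)) Q) ?leq_maxr//.
rewrite (@poly_act_widen (maxn (size P) (size Q)) (P + Q)) ?size_polyD//.
by rewrite -big_split; apply: eq_bigr => i _; rewrite coefD mulrDl.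
Qed.

Lemma poly_actZ a P h k : poly_act (a *: P) h k = a * poly_act P h k.
Proof.
rewrite (@poly_act_widen (size P) (a *: P)) ?size_scale_leq// mulr_sumr.
by apply: eq_bigr => i _; rewrite coefZ mulrA.
Qed.

Lemma poly_actN P h k : poly_act (- P) h k = - poly_act P h k.
Proof. by rewrite -scaleN1r poly_actZ mulN1r. Qed.

Lemma poly_act_sum (I : Type) (r : seq I) (F : I -> {poly R}) h k :
  poly_act (\sum_(i <- r) F i) h k = \sum_(i <- r) poly_act (F i) h k.
Proof.
by apply: (big_morph (fun P => poly_act P h k)) => [P Q|];
  rewrite ?poly_actD ?poly_act0.
Qed.

Lemma poly_actXnM n P h k : poly_act ('X^n * P) h k = poly_act P h (k + n%:Z).
Proof.
rewrite (@poly_act_widen (n + size P)); last first.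
  by apply: leq_trans (size_polyMleq _ _) _; rewrite size_polyXn.
rewrite big_split_ord /= big1 ?add0r => [|i _].
  apply: eq_bigr => i _; rewrite coefXnM ltnNge leq_addr /= addKn.
  by rewrite PoszD addrA.
by rewrite coefXnM ltn_ord mul0r.
Qed.

Lemma poly_act1 h k : poly_act 1 h k = h k.
Proof. by rewrite /poly_act size_poly1 big_ord1 coef1 mul1r addr0. Qed.

Lemma poly_actXn n h k : poly_act 'X^n h k = h (k + n%:Z).
Proof. by rewrite -[X in poly_act X]mulr1 poly_actXnM poly_act1. Qed.

Lemma poly_actM P Q h k : poly_act (P * Q) h k = poly_act P (poly_act Q h) k.
Proof.
rewrite -{1}[P]coefK poly_def mulr_suml poly_act_sum; apply: eq_bigr => i _.
by rewrite -scalerAl poly_actZ poly_actXnM.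
Qed.

End PolynomialAction.

(** * Uniform laws as generating polynomials, and their smoothing effect *)

Definition unif_poly (R : fieldType) l : {poly R} :=
  l%:R^-1 *: \sum_(i < l) 'X^(i.+1).

Arguments unif_poly R l : clear implicits.

Section UniformPolynomial.
Variable R : realFieldType.
Implicit Types (h : int -> R) (k : int).

Lemma poly_act_unif l h k :
  poly_act (unif_poly R l) h k = l%:R^-1 * \sum_(i < l) h (k + i.+1%:Z).
Proof.
rewrite poly_actZ poly_act_sum; congr (_ * _).
by apply: eq_bigr => i _; rewrite poly_actXn.
Qed.

Lemma unif_polyE l : unif_poly R l = l%:R^-1 *: ('X * \sum_(i < l) 'X^i).
Proof. by rewrite mulr_sumr; under [in RHS]eq_bigr do rewrite -exprS. Qed.

Lemma subX_unif_poly l :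
  (1 - 'X) * unif_poly R l = l%:R^-1 *: ('X * (1 - 'X^l)).
Proof.
rewrite unif_polyE -scalerAr; congr (_ *: _).
by rewrite mulrCA -(opprB 'X^l) subrX1 -mulNr opprB.
Qed.

Lemma unif_poly_double a :
  unif_poly R a.*2 = unif_poly R a * (2^-1 *: (1 + 'X^a)).
Proof.
rewrite !unif_polyE -scalerAr -scalerAl scalerA; congr (_ *: _).
  by rewrite -muln2 natrM invfM mulrC.
rewrite -mulrA; congr (_ * _); rewrite -addnn big_split_ord /= mulrDr mulr1.
congr (_ + _); rewrite mulr_suml; apply: eq_bigr => i _.
by rewrite exprD mulrC.
Qed.

Lemma norm_poly_act_unif_le l n h c k : (0 < l)%N ->
  (forall k, `|h k| <= c) -> `|poly_act (unif_poly R l ^+ n) h k| <= c.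
Proof.
move=> l0 hc; elim: n k => [|n IHn] k; first by rewrite expr0 poly_act1.
rewrite exprS poly_actM poly_act_unif normrM ger0_norm ?invr_ge0//.
rewrite mulrC ler_pdivrMr ?ltr0n// (le_trans (ler_norm_sum _ _ _))//.
rewrite (le_trans (ler_sum _ (fun i _ => IHn _)))//.
by rewrite sumr_const card_ord mulr_natr.
Qed.

Lemma poly_act_half_binomial a n h k :
  poly_act ((1 - 'X^a) * (2^-1 *: (1 + 'X^a)) ^+ n) h k =
  2^-1 ^+ n * \sum_(i < n.+1)
    'C(n, i)%:R * (h (k + (i * a)%:Z) - h (k + (i.+1 * a)%:Z)).
Proof.
rewrite exprZn -scalerAr poly_actZ [1 + 'X^a]addrC exprD1n.
congr (_ * _); rewrite mulr_sumr poly_act_sum; apply: eq_bigr => i _.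
rewrite -scaler_nat -scalerAr -exprM mulnC poly_actZ mulrBl mul1r.
by rewrite poly_actD poly_actN -exprD -mulSn !poly_actXn.
Qed.

End UniformPolynomial.

(* Writing l = 2 a, the uniform law on {1, ..., l} is the convolution of the
   uniform law on {1, ..., a} with the uniform law on {0, a}. One factor of the
   former turns the difference operator into a^-1 times the difference at
   distance a, which the latter factors then smooth like a binomial law. *)
Lemma norm_poly_act_diff_unif_le (R : rcfType) l n (h : int -> R) k :
  (0 < l)%N -> ~~ odd l -> (forall k, 0 <= h k <= 1) ->
  `|poly_act ((1 - 'X) * unif_poly R l ^+ n.+1) h k| <=
  2 / l%:R / Num.sqrt n.+2%:R.
Proof.
move=> l0 l_even h01.
have [a a0 ->] : exists2 a, (0 < a)%N & l = a.*2 by exists l./2; lia.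
pose M : {poly R} := 2^-1 *: (1 + 'X^a).
(* Of the n + 1 factors for the law on {1, ..., a}, one is absorbed by [1 - 'X]. The other n, and
   the remaining translation by 1, do not increase the sup norm, so only the binomial smoothing by
   [M ^+ n.+1] has to be estimated. *)
have -> : (1 - 'X) * unif_poly R a.*2 ^+ n.+1 =
    a%:R^-1 *: (unif_poly R a ^+ n * ('X^1 * ((1 - 'X^a) * M ^+ n.+1))).
  rewrite unif_poly_double -/M exprMn exprS mulrA mulrA subX_unif_poly.
  rewrite -!scalerAl; congr (_ *: _); rewrite expr1; ring.
have -> : 2 / a.*2%:R = a%:R^-1 :> R.
  by rewrite -muln2 natrM invfM mulrCA divff ?mulr1 ?pnatr_eq0.
rewrite poly_actZ normrM ger0_norm ?invr_ge0// ler_wpM2l ?invr_ge0//.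
rewrite poly_actM; apply: norm_poly_act_unif_le => // {}k.
rewrite poly_actXnM poly_act_half_binomial exprVn.
rewrite normrM ger0_norm ?invr_ge0 ?exprn_ge0// mulrC.
rewrite (le_trans _ (bin_half_le R n.+1))// ler_wpM2r ?invr_ge0 ?exprn_ge0//.
by apply: (@sum_bin_sub_le _ (fun i => h (k + 1 + (i * a)%:Z))) => i.
Qed.

(** * Countable decompositions along an integer value *)

Lemma pickle_fiber (b : int) : pickle @^-1` [set pickle b] = [set b].
Proof.
by apply/seteqP; split=> [a /= /(pcan_inj pickleK)|a /= ->].
Qed.

(** Series over the integers are written as series over their codes in nat; a number that codes no
    integer contributes an empty fiber. *)
Lemma pickle_fiber_cases n :
  (pickle @^-1` [set n] : set int) = set0 \/
  exists b : int, pickle @^-1` [set n] = [set b].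
Proof.
have [->|/set0P[b /= <-]] := eqVneq (pickle @^-1` [set n] : set int) set0.
  by left.
by right; exists b; exact: pickle_fiber.
Qed.

Lemma trivIset_pickle_fiber : trivIset setT (fun n => pickle @^-1` [set n] : set int).
Proof. by move=> i j _ _ [b [/= <- <-]]. Qed.

Lemma bigcup_pickle_fiber : \bigcup_n (pickle @^-1` [set n] : set int) = setT.
Proof. by apply/seteqP; split=> // b _; exists (pickle b). Qed.

Lemma measurable_preimage_int d (T : measurableType d) (f : T -> int) A :
  measurable_fun setT f -> measurable (f @^-1` A).
Proof. by move=> mf; rewrite -[X in measurable X]setTI; exact: mf. Qed.

Section IntegerLaws.
Local Open Scope ereal_scope.
Context d (T : measurableType d) (R : realType) (P : probability T R).

Lemma measure_int_fibers (f : T -> int) C :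
  measurable_fun setT f -> measurable C ->
  P C = \sum_(n <oo) P (f @^-1` (pickle @^-1` [set n]) `&` C).
Proof.
move=> mf mC; rewrite -measure_semi_bigcup.
- by rewrite -setI_bigcupl -preimage_bigcup bigcup_pickle_fiber setTI.
- by move=> n; apply: measurableI => //; exact: measurable_preimage_int.
- by move=> i j _ _ [t [[/= <- _] [/= <- _]]].
- apply: bigcup_measurable => n _.
  by apply: measurableI => //; exact: measurable_preimage_int.
Qed.

End IntegerLaws.

(** * Integrals against a law on the integers with mass at least p on 1, ..., l *)

Section IntegerIntegrals.
Context (R : realType) (mu : probability int R).

Lemma integral_int_fibers (f : int -> \bar R) : (forall b, 0 <= f b)%E ->
  (\int[mu]_b f b = \sum_(n <oo) \int[mu]_(b in pickle @^-1` [set n]) f b)%E.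
Proof.
move=> f0; rewrite -ge0_integral_bigcup //.
- by rewrite bigcup_pickle_fiber.
- exact: trivIset_pickle_fiber.
Qed.

Lemma integral_int_set1 (f : int -> \bar R) b :
  (\int[mu]_(a in [set b]) f a = f b * mu [set b])%E.
Proof.
rewrite -integral_cst //.
by apply: eq_integral => a; rewrite inE => ->.
Qed.

Lemma Rintegral_int_cst (c : R) : \int[mu]_b c = c.
Proof.
rewrite Rintegral_cst // [X in fine X](_ : _ = 1%E) ?mulr1 //.
exact: probability_setT.
Qed.

Lemma integrable_bounded_int (f : int -> R) (c : R) :
  (forall b, `|f b| <= c) -> mu.-integrable setT (EFin \o f).
Proof.
move=> fc; apply: measurable_bounded_integrable => //.
  by apply: le_lt_trans (probability_le1 mu _) _; rewrite ?ltry.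
exists c; split=> [|M cM b _ /=]; first exact: num_real.
exact: le_trans (fc b) (ltW cM).
Qed.

Lemma Rintegral_int_sum n (a : nat -> R) (f : nat -> int -> R) (c : R) :
  (forall i b, `|f i b| <= c) ->
  \int[mu]_b (\sum_(i < n) a i * f i b) = \sum_(i < n) a i * \int[mu]_b f i b.
Proof.
move=> fc; elim: n => [|n IHn].
  under eq_Rintegral do rewrite big_ord0.
  by rewrite big_ord0 Rintegral_cst // mul0r.
under eq_Rintegral do rewrite big_ord_recr /=.
rewrite big_ord_recr /= RintegralD //; first by rewrite IHn RintegralZl //;
  exact: integrable_bounded_int.
- apply: (@integrable_bounded_int _ (\sum_(i < n) `|a i| * c)) => b.
  rewrite (le_trans (ler_norm_sum _ _ _))// ler_sum// => i _.
  by rewrite normrM ler_wpM2l.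
- apply: (@integrable_bounded_int _ (`|a n| * c)) => b.
  by rewrite normrM ler_wpM2l.
Qed.

(** As f >= 0, restricting the integral to the points 1, ..., l only lowers it, and each of these
    points carries mass at least p. The bound c provides integrability. *)
Lemma Rintegral_int_ge (f : int -> R) l (p c : R) :
  (forall b, 0 <= f b <= c) ->
  (forall k, (1 <= k <= l)%N -> (p%:E <= mu [set k%:Z])%E) ->
  p * \sum_(i < l) f i.+1%:Z <= \int[mu]_b f b.
Proof.
move=> f0c p_le.
have f0 b : 0 <= f b by case/andP: (f0c b).
have fint : mu.-integrable setT (EFin \o f).
  apply: (@integrable_bounded_int _ c) => b.
  by rewrite ger0_norm //; case/andP: (f0c b).
rewrite -lee_fin /Rintegral fineK; last exact: integrable_fin_num.
pose F (k : nat) := [set k.+1%:Z].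
apply: (@le_trans _ _
  (\int[mu]_(b in \big[setU/set0]_(k <- iota 0 l) F k) (f b)%:E)%E); last first.
  by apply: ge0_subset_integral => // b _; rewrite lee_fin.
rewrite ge0_integral_bigsetU ?iota_uniq//; last first.
- by move=> b _; rewrite lee_fin.
- by move=> i j _ _ [b [/= -> []]].
rewrite mulr_sumr -sumEFin -(big_mkord xpredT (fun i => (p * f i.+1%:Z)%:E)).
rewrite /index_iota subn0 big_seq [leRHS]big_seq; apply: lee_sum => i.
rewrite mem_iota add0n => /andP[_ il].
rewrite integral_int_set1 EFinM muleC; apply: lee_wpmul2l; first by rewrite lee_fin.
exact: p_le.
Qed.

(** Removing mass p at each of 1, ..., l from [mu] leaves a positive measure of mass 1 - l p.
    Instead of building that measure, the proof applies the previous lemma to the nonnegative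
    functions c + f and c - f. *)
Lemma norm_Rintegral_minorized_le (f : int -> R) l (p c : R) :
  (forall b, `|f b| <= c) ->
  (forall k, (1 <= k <= l)%N -> (p%:E <= mu [set k%:Z])%E) ->
  `|\int[mu]_b f b - p * \sum_(i < l) f i.+1%:Z| <= (1 - l%:R * p) * c.
Proof.
move=> fc p_le.
have bnd b : - c <= f b <= c by rewrite -ler_norml.
(* The sign s = 1 or -1 treats both functions at once. *)
have ge (s : R) : s ^+ 2 = 1 ->
    p * (l%:R * c + s * \sum_(i < l) f i.+1%:Z) <= c + s * \int[mu]_b f b.
  move=> s2.
  have s1 : s = 1 \/ s = - 1 by move/eqP: s2; rewrite sqrf_eq1 => /orP[]/eqP; auto.
  have := @Rintegral_int_ge (fun b => c + s * f b) l p (2 * c) _ p_le.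
  rewrite big_split /= sumr_const card_ord -[c *+ l]mulr_natl -mulr_sumr.
  rewrite RintegralD //; first last.
  - apply: (@integrable_bounded_int _ c) => b; rewrite normrM.
    by case: s1 => ->; rewrite ?normrN normr1 mul1r.
  - by apply: (@integrable_bounded_int _ `|c|) => b.
  rewrite RintegralZl //; last exact: integrable_bounded_int fc.
  rewrite Rintegral_int_cst; apply => b.
  by have := bnd b; case: s1 => ->; lra.
have := ge 1 (expr1n _ _); have := ge (- 1); rewrite sqrrN expr1n => /(_ erefl).
rewrite ler_norml; lra.
Qed.

End IntegerIntegrals.

(** * Sums of independent integer variables *)

Section IndependentSums.
Context d (T : measurableType d) (R : realType) (P : probability T R).

(** Indexing by a list allows summands to be peeled off one at a time, in a chosen order. *)
Definition RV_seq_sum (I : Type) (X : I -> {RV P >-> int}) (s : seq I) : T -> int :=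
  fun t => \sum_(j <- s) X j t.

Lemma measurable_RV_seq_sum (I : Type) (X : I -> {RV P >-> int}) (s : seq I) :
  measurable_fun setT (RV_seq_sum X s).
Proof.
rewrite /RV_seq_sum; elim: s => [|i s IHs].
  by under eq_fun do rewrite big_nil; exact: measurable_cst.
under eq_fun do rewrite big_cons.
by apply: measurable_fun_int_add => //; exact: measurable_funPT.
Qed.

(** Induction on s, splitting on the value b of the head [X i]. Where [X i] equals b, the event on
    the sum becomes an event on the shorter sum, and [X i = b] joins the events indexed by J; hence
    J and B must vary in the induction. *)
Lemma independent_RVs_sum (I : finType) (X : I -> {RV P >-> int})
    (s : seq I) (J : {set I}) (B : I -> set int) (A : set int) :
  independent_RVs X -> uniq s -> {in s, forall j, j \notin J} ->
  (P (RV_seq_sum X s @^-1` A `&`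
      \bigcap_(j in [set` J]) (X j @^-1` B j)) =
   P (RV_seq_sum X s @^-1` A) *
   \prod_(j in J) P (X j @^-1` B j))%E.
Proof.
move=> indep; elim: s J B A => [|i s IHs] J B A.
  move=> _ _; have [A0|A0] := pselect (A 0).
    have -> : RV_seq_sum X [::] @^-1` A = setT.
      by apply/seteqP; split=> // t _ /=; rewrite /RV_seq_sum big_nil.
    by rewrite setTI probability_setT mul1e; apply: indep.
  have -> : RV_seq_sum X [::] @^-1` A = set0.
    by apply/seteqP; split=> // t /=; rewrite /RV_seq_sum big_nil.
  by rewrite set0I measure0 mul0e.
move=> /= /andP[iNs uniq_s] sJ.
have iNJ : i \notin J by apply: sJ; rewrite mem_head.
set S := RV_seq_sum X (i :: s).
set C := \bigcap_(j in _) _.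
have mS : measurable_fun setT S by exact: measurable_RV_seq_sum.
have mC : measurable C.
  apply: fin_bigcap_measurable => // j _; exact: measurable_preimage_int.
have mX : measurable_fun setT (X i) by exact: measurable_funPT.
have fin_prod : (\prod_(j in J) P (X j @^-1` B j))%E \is a fin_num.
  by apply: prode_fin_num => j _; apply: fin_num_measure; exact: measurable_preimage_int.
rewrite (measure_int_fibers P mX); last first.
  by apply: measurableI => //; exact: measurable_preimage_int.
rewrite [in RHS](measure_int_fibers P mX); last exact: measurable_preimage_int.
rewrite -(fineK fin_prod) muleC -nneseriesZl //; apply: eq_eseriesr => n _.
rewrite fineK //.
have [->|[b ->]] := pickle_fiber_cases n.
  by rewrite preimage_set0 !set0I measure0 mule0.
pose A' := [set a : int | A (b + a)].
have SE : X i @^-1` [set b] `&` S @^-1` A =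
    RV_seq_sum X s @^-1` A' `&` X i @^-1` [set b].
  apply/seteqP; split=> t /=; rewrite /S /RV_seq_sum big_cons => -[].
    by move=> ->.
  by move=> ? ->.
(* [B'] prescribes the value b at i and agrees with B on J, which does not contain i. *)
pose B' j := if j == i then [set b] else B j.
have B'E j : j \in J -> B' j = B j.
  by rewrite /B'; case: eqVneq iNJ => // -> /negP.
have CE : X i @^-1` [set b] `&` C = \bigcap_(j in [set` i |: J]) (X j @^-1` B' j).
  apply/seteqP; split=> [t [/= Xib Ct] j /=|t Bt].
    by rewrite !inE => /orP[/eqP ->|jJ]; [rewrite /B' eqxx|rewrite B'E //; exact: Ct].
  split=> [|j /= jJ].
    by have := Bt i; rewrite /B' eqxx; apply; rewrite /= setU11.
  by have := Bt j; rewrite B'E //; apply; rewrite /= !inE jJ orbT.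
have CE0 : X i @^-1` [set b] =
    \bigcap_(j in [set` [set i]%SET]) (X j @^-1` B' j).
  apply/seteqP; split=> [t /= Xib j /=|t Bt].
    by rewrite inE => /eqP ->; rewrite /B' eqxx.
  by have := Bt i; rewrite /B' eqxx; apply; rewrite /= set11.
have sub1 : {in s, forall j, j \notin [set i]%SET}.
  by move=> j js; rewrite inE; apply: contraNneq iNs => <-.
have sub2 : {in s, forall j, j \notin i |: J}.
  move=> j js; rewrite !inE negb_or sJ ?in_cons ?js ?orbT // andbT.
  by apply: contraNneq iNs => <-.
(* The induction hypothesis is used with [[set i]] on the right side and with [i |: J] on the left;
   the factor for [X i] then cancels. *)
rewrite setIA SE [in RHS]CE0 IHs // -setIA CE IHs // big_set1 big_setU1 //=.
rewrite [RHS]muleC -muleA; congr (_ * (_ * _))%E.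
by apply: eq_bigr => j jJ; rewrite B'E.
Qed.

(** Convolution formula, obtained by comparing the contributions of each value b of X. *)
Lemma prob_add_indep (X : {RV P >-> int}) (S : T -> int) (A : set int) :
  measurable_fun setT S ->
  (forall b A', P (S @^-1` A' `&` X @^-1` [set b]) =
    P (S @^-1` A') * P (X @^-1` [set b]))%E ->
  (P ((fun t => X t + S t)%R @^-1` A) =
   \int[distribution P X]_b P (S @^-1` [set a | A (b + a)%R]))%E.
Proof.
move=> mS indep; have mX : measurable_fun setT X by exact: measurable_funPT.
rewrite (measure_int_fibers P mX); last first.
  by apply: measurable_preimage_int; exact: measurable_fun_int_add.
rewrite integral_int_fibers //; apply: eq_eseriesr => n _.
have [->|[b ->]] := pickle_fiber_cases n.
  by rewrite preimage_set0 set0I measure0 integral_set0.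
rewrite integral_int_set1 -indep; congr (P _).
by apply/seteqP; split=> t /= [] => [->|? ->].
Qed.

End IndependentSums.

(** * The effect of one more summand on the difference bounds *)

Section DifferenceBound.
Variable R : realType.

Lemma poly_act_Rintegral (mu : probability int R) (Q : {poly R}) (f : int -> R)
    (c : R) k :
  (forall b, `|f b| <= c) ->
  poly_act Q (fun k => \int[mu]_b f (k + b)) k = \int[mu]_b poly_act Q f (k + b).
Proof.
move=> fc; rewrite /poly_act.
rewrite (Rintegral_int_sum mu (size Q) (fun i => Q`_i)
  (f := fun i b => f (k + b + i%:Z)) (c := c)) //.
by apply: eq_bigr => i _; under [in RHS]eq_Rintegral do rewrite addrAC.
Qed.

(** The minorization estimate is applied to b |-> (D U^n f)(k + b), bounded by [beta n]. Its sum
    over b = 1, ..., l is l times (D U^(n+1) f)(k), which is where the extra factor U comes from. *)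
Lemma norm_poly_act_diff_step (mu : probability int R) l (p : R)
    (f : int -> R) (beta : nat -> R) n k :
  (0 < l)%N -> 0 < p ->
  (forall j, (1 <= j <= l)%N -> (p%:E <= mu [set j%:Z])%E) ->
  (forall b, 0 <= f b <= 1) ->
  (forall n k, `|poly_act ((1 - 'X) * unif_poly R l ^+ n) f k| <= beta n) ->
  `|poly_act ((1 - 'X) * unif_poly R l ^+ n) (fun k => \int[mu]_b f (k + b)) k| <=
  l%:R * p * beta n.+1 + (1 - l%:R * p) * beta n.
Proof.
move=> l0 p0 p_le f01 fbeta.
have q0 : 0 <= l%:R * p by rewrite mulr_ge0 // ltW.
rewrite (@poly_act_Rintegral _ _ _ 1); last first.
  by move=> b; rewrite ler_norml; have := f01 b; lra.
set Q := _ * _.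
have := norm_Rintegral_minorized_le (fun b => fbeta n (k + b)) p_le.
have -> : p * \sum_(i < l) poly_act Q f (k + i.+1%:Z) =
    l%:R * p * poly_act ((1 - 'X) * unif_poly R l ^+ n.+1) f k.
  rewrite exprS mulrCA poly_actM poly_act_unif; field.
  by rewrite pnatr_eq0 -lt0n.
move/(le_trans (lerB_dist _ _)); rewrite normrM (ger0_norm q0).
have : l%:R * p * `|poly_act ((1 - 'X) * unif_poly R l ^+ n.+1) f k| <=
    l%:R * p * beta n.+1 by rewrite ler_wpM2l.
lra.
Qed.

Lemma minorized_mass_le1 (mu : probability int R) l (p : R) :
  (forall j, (1 <= j <= l)%N -> (p%:E <= mu [set j%:Z])%E) -> l%:R * p <= 1.
Proof.
move=> p_le.
have := @Rintegral_int_ge _ mu (fun=> 1) l p 1 _ p_le.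
rewrite sumr_const card_ord Rintegral_int_cst mulrC => le1.
by apply: le1 => _; rewrite lexx ler01.
Qed.

End DifferenceBound.

(** Cleared of denominators, this is q (m - 1 + q) >= 0. By convexity the mixture is at least 1 / (m
    + q), so a gain of q in the denominator is out of reach; q / 2 is enough here. *)
Lemma inv_mixture_le (R : realFieldType) (q m : R) : 0 <= q <= 1 -> 1 <= m ->
  q / (m + 1) + (1 - q) / m <= (m + q / 2)^-1.
Proof.
move=> q01 m1.
have -> : q / (m + 1) + (1 - q) / m = (m + 1 - q) / (m * (m + 1)).
  by field; rewrite !lt0r_neq0 //; lra.
rewrite ler_pdivrMr; last nra.
rewrite mulrC ler_pdivlMr; nra.
Qed.

(** * Total variation distance as a supremum *)

Section TotalVariation.
Variable R : realType.
Implicit Types mu nu : probability int R.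

Lemma le_dTV mu nu A : `|fine (mu A) - fine (nu A)| <= dTV mu nu.
Proof.
apply: ub_le_sup; last by exists A.
exists 1 => _ [B _ <-].
have b01 (la : probability int R) : 0 <= fine (la B) <= 1.
  rewrite fine_ge0 //= -lee_fin fineK ?fin_num_measure //.
  exact: probability_le1.
by have := b01 mu; have := b01 nu; rewrite ler_norml; lra.
Qed.

Lemma dTV_ge0 mu nu : 0 <= dTV mu nu.
Proof. exact: le_trans (normr_ge0 _) (le_dTV mu nu set0). Qed.

Lemma dTV_le mu nu c :
  (forall A, `|fine (mu A) - fine (nu A)| <= c) -> dTV mu nu <= c.
Proof.
move=> le_c; apply: ge_sup => [|_ [A _ <-] //].
by exists `|fine (mu set0) - fine (nu set0)|, set0.
Qed.

End TotalVariation.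

(** * Induction on the number of summands *)

Section SmoothedSum.
Context d (T : measurableType d) (R : realType) (P : probability T R).
Variables (I : finType) (X : I -> {RV P >-> int}).
Hypothesis X_indep : independent_RVs X.
Variable A : set int.

(** For the full sum W, its values at 0 and 1 are P(W \in A) and P(W + 1 \in A), whose difference is
    to be bounded uniformly in A. *)
Definition shifted_prob (s : seq I) (k : int) : R :=
  fine (P (RV_seq_sum X s @^-1` [set a | A (a + k)])).

Lemma shifted_prob01 s k : 0 <= shifted_prob s k <= 1.
Proof.
rewrite /shifted_prob fine_ge0 //= -lee_fin fineK.
  by apply: probability_le1; apply: measurable_preimage_int;
    exact: measurable_RV_seq_sum.
by apply: fin_num_measure; apply: measurable_preimage_int;
  exact: measurable_RV_seq_sum.
Qed.

Lemma shifted_prob_cons i s k : uniq (i :: s) ->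
  shifted_prob (i :: s) k =
  \int[distribution P (X i)]_b shifted_prob s (k + b).
Proof.
move=> /= /andP[iNs uniq_s].
have mS := @measurable_RV_seq_sum _ _ _ P _ X s.
have sub B A' :
    (P (RV_seq_sum X s @^-1` A' `&` X i @^-1` B) =
     P (RV_seq_sum X s @^-1` A') * P (X i @^-1` B))%E.
  have := @independent_RVs_sum _ _ _ P _ X s [set i]%SET (fun=> B) A'
    X_indep uniq_s.
  rewrite big_set1 => <-; last first.
    by move=> j js; rewrite inE; apply: contraNneq iNs => <-.
  congr (P (_ `&` _)); apply/seteqP; split=> [t /= Xit j /=|t]; last first.
    by apply; rewrite /= set11.
  by rewrite inE => /eqP ->.
rewrite /shifted_prob /Rintegral; congr fine.
have -> : RV_seq_sum X (i :: s) = (fun t => X i t + RV_seq_sum X s t).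
  by apply/funext => t; rewrite /RV_seq_sum big_cons.
rewrite prob_add_indep //; apply: eq_integral => b _.
rewrite fineK; last first.
  by apply: fin_num_measure; exact: measurable_preimage_int.
congr (P (_ @^-1` _)); apply/seteqP.
by split=> a /=; rewrite [b + a]addrC -addrA [b + k]addrC.
Qed.

(* Seen as a function F of n and of the size i of r, the right-hand side satisfies
   q F n.+1 i + (1 - q) F n i <= F n i.+1 with q = l p, and F n 0 dominates
   2 / (l sqrt (n + 1)) by AM-GM. The theorem takes s = sqrt (N l p) for N
   summands. *)
Lemma norm_diff_shifted_prob_le (r : seq I) (m : I) l (p s : R) n k :
  (0 < l)%N -> ~~ odd l -> 0 < p -> 0 < s ->
  (forall i j, (1 <= j <= l)%N -> (p%:E <= P [set t | X i t = j%:Z])%E) ->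
  uniq (r ++ [:: m]) ->
  `|poly_act ((1 - 'X) * unif_poly R l ^+ n) (shifted_prob (r ++ [:: m])) k| <=
  (dTV (distribution P (X m)) (distribution P (RV_succ (X m))) + s / l%:R) /
    (n.+1%:R + (size r)%:R * (l%:R * p) / 2) + (l%:R * s)^-1.
Proof.
set dm := dTV _ _; move=> l0 l_even p0 s0 p_le.
have l0' : 0 < l%:R :> R by rewrite ltr0n.
have dm0 : 0 <= dm by exact: dTV_ge0.
elim: r n k => [|i r IHr] n k uniq_r.
  rewrite !mul0r addr0; case: n => [|n].
    rewrite expr0 mulr1 poly_actD poly_actN poly_act1 -['X]expr1 poly_actXn.
    have H k' : shifted_prob [:: m] k' =
        fine (distribution P (X m) [set a | A (a + k')]).
      congr (fine (P _)); apply/seteqP.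
      by split=> t /=; rewrite /RV_seq_sum big_seq1.
    have -> : shifted_prob [:: m] (k + 1) =
        fine (distribution P (RV_succ (X m)) [set a | A (a + k)]).
      rewrite H; congr (fine (P _)); apply/seteqP.
      by split=> t /=; rewrite /RV_succ addrAC addrA.
    rewrite H (le_trans (le_dTV _ _ _)) // -/dm divr1 -addrA lerDl.
    by rewrite addr_ge0 // ?divr_ge0 ?invr_ge0 ?mulr_ge0 // ltW.
  apply: le_trans (norm_poly_act_diff_unif_le _ _ l0 l_even (shifted_prob01 _)) _.
  set y := Num.sqrt _.
  have y0 : 0 < y by rewrite sqrtr_gt0.
  have -> : n.+2%:R = y ^+ 2 by rewrite sqr_sqrtr.
  (* AM-GM in the form (y - s)^2 >= 0: the gap between the two bounds is a square term plus a
     multiple of [dm]. *)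
  rewrite -subr_ge0.
  have -> : (dm + s / l%:R) / y ^+ 2 + (l%:R * s)^-1 - 2 / l%:R / y =
      dm / y ^+ 2 + (y - s) ^+ 2 / (l%:R * s * y ^+ 2).
    by field; rewrite !lt0r_neq0.
  by rewrite addr_ge0 ?divr_ge0 ?sqr_ge0 ?mulr_ge0 ?(ltW s0) ?(ltW y0).
have uniq_r' : uniq (r ++ [:: m]) by case/andP: uniq_r.
have q1 : l%:R * p <= 1.
  by apply: (@minorized_mass_le1 _ (distribution P (X i))) => j; exact: p_le.
rewrite (@eq_poly_act _ _ _ (fun k =>
  \int[distribution P (X i)]_b shifted_prob (r ++ [:: m]) (k + b))); last first.
  by move=> k'; exact: shifted_prob_cons.
pose beta j := (dm + s / l%:R) / (j.+1%:R + (size r)%:R * (l%:R * p) / 2)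
  + (l%:R * s)^-1.
apply: le_trans (norm_poly_act_diff_step
  (mu := distribution P (X i)) (beta := beta) n k l0 p0 (p_le i)
  (shifted_prob01 _) (fun j k' => IHr j k' uniq_r')) _.
rewrite {}/beta /=; set q := l%:R * p; set a := dm + _; set b := (l%:R * s)^-1.
have q0 : 0 < q by rewrite mulr_gt0.
have a0 : 0 <= a by rewrite addr_ge0 ?divr_ge0 // ltW.
set M := n.+1%:R + (size r)%:R * q / 2.
have M1 : 1 <= M.
  by rewrite /M -natr1 -addrA addrCA lerDl addr_ge0 ?divr_ge0 ?mulr_ge0 // ltW.
have -> : n.+2%:R + (size r)%:R * q / 2 = M + 1 by rewrite /M -[n.+2%:R]natr1 addrAC.
have -> : n.+1%:R + (size (i :: r))%:R * q / 2 = M + q / 2.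
  by rewrite /M /= -[(size r).+1%:R]natr1; lra.
(* The constant b survives because the weights q and 1 - q add up to 1; only the fractions need
   [inv_mixture_le]. *)
have -> : q * (a / (M + 1) + b) + (1 - q) * (a / M + b) =
    a * (q / (M + 1) + (1 - q) / M) + b by ring.
by rewrite lerD2r ler_wpM2l // inv_mixture_le // q1 ltW.
Qed.

End SmoothedSum.

(* X_1, ..., X_n is indexed by 'I_n = {0, ..., n-1}; m is the last index. *)
Theorem proposition6p1p1
  (d : measure_display) (T : measurableType d) (R : realType)
  (P : probability T R)
  (n : nat) (n_ge2 : (2 <= n)%N)
  (X : 'I_n -> {RV P >-> int}) (X_indep : independent_RVs X)
  (m : 'I_n) (m_last : m.+1 = n :> nat)
  (l : nat) (l_gt0 : (0 < l)%N) (l_even : ~~ odd l)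
  (p : R) (p_gt0 : 0 < p)
  (p_le : forall (j : 'I_n) (k : nat), (1 <= k <= l)%N ->
    (p%:E <= P [set t | X j t = k%:Z])%E) :
  let W : {RV P >-> int} := RV_sum X in
  let dn : R := dTV (distribution P (X m)) (distribution P (RV_succ (X m))) in
  dTV (distribution P W) (distribution P (RV_succ W)) <=
    4 / (l%:R * Num.sqrt (n%:R * l%:R * p)) + 8 * dn / (n%:R * l%:R * p).
Proof.
cbv zeta; pose W : {RV P >-> int} := RV_sum X; rewrite -/W.
set dn := dTV (distribution P (X m)) _.
have l0 : 0 < l%:R :> R by rewrite ltr0n.
have n0 : 0 < n%:R :> R by rewrite ltr0n; lia.
set s := Num.sqrt _; have s0 : 0 < s by rewrite sqrtr_gt0 !mulr_gt0.
have s2 : s ^+ 2 = n%:R * l%:R * p by rewrite sqr_sqrtr // !mulr_ge0 // ltW.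
have dn0 : 0 <= dn by exact: dTV_ge0.
have q1 : l%:R * p <= 1.
  by apply: (@minorized_mass_le1 _ (distribution P (X m))) => j; exact: p_le.
(* Placing m at the end of the list makes [X m] the base case of the induction, so that [dn] enters
   the bound. *)
pose r := enum (predC1 m).
have uniq_r : uniq (r ++ [:: m]).
  by rewrite cat_uniq enum_uniq /= orbF andbT mem_enum inE eqxx.
have size_r : (size r)%:R = n%:R - 1 :> R.
  rewrite -cardE cardC1 card_ord -subn1 natrB //; lia.
have WE t : W t = RV_seq_sum X (r ++ [:: m]) t.
  rewrite /RV_seq_sum big_cat big_seq1 big_enum /= addrC.
  by rewrite -[LHS]/(\sum_(j < n) X j t) (bigD1 m).
apply: dTV_le => A.
(* With no factor U and k = 0, the left side is |P(W \in A) - P(W + 1 \in A)|. *)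
have := norm_diff_shifted_prob_le X_indep A 0 0 l_gt0 l_even p_gt0 s0 p_le uniq_r.
rewrite expr0 mulr1 poly_actD poly_actN poly_act1 -['X]expr1 poly_actXn -/dn.
have -> : shifted_prob X A (r ++ [:: m]) 0 = fine (distribution P W A).
  by congr (fine (P _)); apply/seteqP; split=> t /=; rewrite -WE addr0.
have -> : shifted_prob X A (r ++ [:: m]) (0 + 1) =
    fine (distribution P (RV_succ W) A).
  by congr (fine (P _)); apply/seteqP; split=> t /=; rewrite -WE add0r.
move=> /le_trans -> //; rewrite size_r -s2.
have -> : (n%:R - 1) * (l%:R * p) / 2 = (s ^+ 2 - l%:R * p) / 2 by rewrite s2; field.
set a := dn + _.
have a0 : 0 <= a by rewrite addr_ge0 ?divr_ge0 // ltW.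
(* Since l p <= 1, the denominator is at least s^2 / 2. The total is then at most 2 dn / s^2 + 3 /
   (l s), within the claimed constants 8 and 4. *)
have : a / (1 + (s ^+ 2 - l%:R * p) / 2) <= a * (2 / s ^+ 2).
  have s20 : 0 < s ^+ 2 by rewrite exprn_gt0.
  rewrite ler_wpM2l // -[2 / _]invf_div lef_pV2 ?posrE; lra.
have -> : a * (2 / s ^+ 2) = 2 * dn / s ^+ 2 + 2 / (l%:R * s).
  by rewrite /a; field; rewrite !lt0r_neq0.
have : 0 <= dn / s ^+ 2 by rewrite divr_ge0 // sqr_ge0.
have : 0 <= (l%:R * s)^-1 by rewrite invr_ge0 mulr_ge0 // ltW.
rewrite -[2 * dn / _]mulrA -[8 * dn / _]mulrA; lra.
Qed.
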